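(* Let $p\ge1$ be an integer, $g_0\in\mathcal G$, let $\varepsilon_n>0$ and $a_n$ be sequences, and for $g\in\mathcal G$ let $g_n:=a_n+g\,(1-a_n\gamma_0)$ and $g_{0,n}:=a_n+g_0\,(1-a_n\gamma_0)$ be the shifted densities. For sufficiently large $K>0$, one has $$d_H(g,g_0)\lesssim d_H(g_n,g_{0,n})$$ for $g\in A_n^c:=\{g\in\mathcal G\mid d_H(g,g_0)>K\varepsilon_n\}$, provided that $$0<a_n\le\frac{K^4\varepsilon_n^4}{(16+K^4\varepsilon_n^4)\gamma_0}.$$
   Context: Setting. $I\subseteq\mathbb R$ is an interval, possibly unbounded, and $w$ is a weight function on $I$ with associated orthogonal polynomial system $\{q_j\}_{j\ge0}$, $q_0\equiv1$, $\int_I q_iq_jw\,dx=\delta_{ij}\gamma_j$; in particular $\gamma_0=\int_I w\,dx<\infty$. $W^p_{2,w}(I)$ is the weighted Sobolev space with norm $\|g\|^2_{W^p_{2,w}}=\sum_{l=0}^p\int_I|g^{(l)}|^2w\,dx$ (weak derivatives). $\mathcal G:=\{g\in W^p_{2,w}(I): g\ge0,\ \int_I g\,w\,dx=1\}$. Hellinger distance: $d_H^2(g_1,g_2)=\int_I(\sqrt{g_1}-\sqrt{g_2})^2w\,dx$. $x_n\lesssim y_n$ means there is a constant $C>0$ (independent of $n$ and, here, of $g\in A_n^c$) with $x_n\le Cy_n$ for all large $n$. *)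

(* Defs.v *)
From HB Require Import structures.
From mathcomp Require Import all_boot all_order all_algebra.
From mathcomp Require Import all_classical all_reals all_analysis.
Set Implicit Arguments.
Unset Strict Implicit.
Unset Printing Implicit Defensive.
Import Order.TTheory GRing.Theory Num.Theory.
Import numFieldNormedType.Exports.
Local Open Scope classical_set_scope.
Local Open Scope ring_scope.

(* [w] is only required to be nonnegative: not being a.e. zero on [I] is forced
   by [ops_norm_gt0], and since [q 0 = 1] one has
   [gamma 0 = \int_I w], which is finite. *)
Record weight_with_ops (R : realType) (I : interval R) (w : R -> R)
    (q : nat -> {poly R}) (gamma : nat -> R) : Prop := WeightWithOps {
  weight_measurable : measurable_fun [set` I] w ;
  weight_ge0 : forall x, x \in I -> 0 <= w x ;
  ops_degree : forall j, size (q j) = j.+1 ;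
  ops_first : q 0%N = 1 ;
  ops_norm_gt0 : forall j, 0 < gamma j ;
  ops_integrable : forall i j, (@lebesgue_measure R).-integrable [set` I]
    (fun x => ((q i).[x] * (q j).[x] * w x)%:E) ;
  ops_orthogonal : forall i j,
    (\int[@lebesgue_measure R]_(x in [set` I])
       ((q i).[x] * (q j).[x] * w x)%:E = ((i == j)%:R * gamma j)%:E)%E }.

Definition test_function (R : realType) (U : set R) (phi : R -> R) : Prop :=
  (forall n x, derivable (derive1n n phi) x 1) /\
  exists K : set R, [/\ compact K, K `<=` U & forall x, ~ K x -> phi x = 0].

Definition weak_derivative (R : realType) (U : set R) (l : nat)
    (f h : R -> R) : Prop :=
  [/\ locally_integrable U f, locally_integrable U h &
    forall phi, test_function U phi ->
      \int[@lebesgue_measure R]_(x in U) (f x * derive1n l phi x) =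
      (-1) ^+ l * \int[@lebesgue_measure R]_(x in U) (h x * phi x)].

(* Functions stand for their classes modulo Lebesgue-null sets. Weak derivatives
   are taken on the interior of [I]; [D l] is the [l]-th one, and the last
   condition says that the squared Sobolev norm of [g] is finite. *)
Definition sobolev2 (R : realType) (p : nat) (I : interval R) (w : R -> R)
    (g : R -> R) : Prop :=
  exists D : nat -> R -> R,
    [/\ D 0%N = g,
        forall l, (l <= p)%N -> measurable_fun [set` I] (D l),
        forall l, (l <= p)%N -> weak_derivative [set` I]° l g (D l) &
        (\sum_(l < p.+1) \int[@lebesgue_measure R]_(x in [set` I])
           (`|D l x| ^+ 2 * w x)%:E < +oo)%E].

Definition sobolev_density (R : realType) (p : nat) (I : interval R)
    (w : R -> R) : set (R -> R) :=
  [set g | [/\ sobolev2 p I w g,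
      {ae @lebesgue_measure R, forall x, x \in I -> 0 <= g x} &
      (\int[@lebesgue_measure R]_(x in [set` I]) (g x * w x)%:E = 1)%E]].

(* Extended-real valued, so that no integrability is built in. *)
Definition hellinger (R : realType) (I : interval R) (w g1 g2 : R -> R) :
    \bar R :=
  sqrte (\int[@lebesgue_measure R]_(x in [set` I])
    ((Num.sqrt (g1 x) - Num.sqrt (g2 x)) ^+ 2 * w x)%:E)%E.

Definition shifted (R : realType) (gamma0 a : R) (g : R -> R) : R -> R :=
  fun x => a + g x * (1 - a * gamma0).

(* Main.v *)
(** Write [c = a * gamma0] and [b = 1 - c]. For [x, y >= 0] both
    [sqrt (a + x b) - sqrt (x b)] and [sqrt (a + y b) - sqrt (y b)] lie in
    [[0, sqrt a]], so the difference of square roots changes by at most [sqrt a]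
    under the shift; integrating, [b d^2 <= 2 d_n^2 + 2 c], where [d] and [d_n]
    are the Hellinger distances before and after it. The bound on [a] says
    [16 c <= b (K eps)^4 < b d^4], and [d^2 <= 2] for densities, so [2 c] is at
    most [b d^2 / 4] and is absorbed on the left; moreover [b >= 4/5]. *)
Require Import Defs.
From mathcomp Require Import all_boot all_order all_algebra.
From mathcomp Require Import all_classical all_reals all_analysis.
From mathcomp Require Import measurable_realfun ring lra.
Import Order.TTheory GRing.Theory Num.Theory.
Import numFieldNormedType.Exports.
Local Open Scope classical_set_scope.
Local Open Scope ring_scope.

Lemma sqrtr_add_le {R : rcfType} {c x : R} : 0 <= c -> 0 <= x ->
  Num.sqrt x <= Num.sqrt (c + x) <= Num.sqrt x + Num.sqrt c.
Proof.
move=> c0 x0; apply/andP; split; first by apply: ler_wsqrtr; rewrite lerDr.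
have cx0 : 0 <= c + x by exact: addr_ge0.
rewrite -ler_sqr ?nnegrE ?addr_ge0 ?sqrtr_ge0// sqrrD !sqr_sqrtr//.
by rewrite [leLHS]addrC lerD2r lerDl mulrn_wge0// mulr_ge0// sqrtr_ge0.
Qed.

(** The factor [b] goes under the roots on the left; this leaves two differences of roots at
    distance at most [Num.sqrt a]. *)
Lemma sqr_sqrtrB_le_shift {R : rcfType} {a b x y : R} :
  0 <= a -> 0 <= b -> 0 <= x -> 0 <= y ->
  (Num.sqrt x - Num.sqrt y) ^+ 2 * b <=
  2 * (Num.sqrt (a + x * b) - Num.sqrt (a + y * b)) ^+ 2 + 2 * a.
Proof.
move=> a0 b0 x0 y0.
have /andP[x1 x2] := sqrtr_add_le a0 (mulr_ge0 x0 b0).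
have /andP[y1 y2] := sqrtr_add_le a0 (mulr_ge0 y0 b0).
rewrite -[X in _ * X](sqr_sqrtr b0) -exprMn mulrBl -!sqrtrM//.
rewrite -[X in _ + 2 * X](sqr_sqrtr a0).
set X := Num.sqrt (x * b) in x1 x2 *; set Y := Num.sqrt (y * b) in y1 y2 *.
set X' := Num.sqrt (a + _) in x1 x2 *; set Y' := Num.sqrt (a + _) in y1 y2 *.
set s := Num.sqrt a in x2 y2 *.
have : (X' - Y' - (X - Y)) ^+ 2 <= s ^+ 2 by nra.
(* With [u = X - Y] and [v = X' - Y'], the identity [2 v^2 + 2 (v - u)^2 - u^2 = (u - 2 v)^2] gives
   the factors 2. *)
have := sqr_ge0 ((X - Y) - 2 * (X' - Y')); nra.
Qed.

Lemma sqr_sqrtrB_le {R : rcfType} {x y : R} : 0 <= x -> 0 <= y ->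
  (Num.sqrt x - Num.sqrt y) ^+ 2 <= x + y.
Proof.
move=> x0 y0; rewrite -[leRHS]addr0 sqrrB !sqr_sqrtr// addrAC lerD2l.
by rewrite oppr_le0 mulrn_wge0// mulr_ge0// sqrtr_ge0.
Qed.

Section HellingerSquare.
Context {d : measure_display} {T : measurableType d} {R : realType}.
Context {mu : {measure set T -> \bar R}} {D : set T} {w : T -> R}.
Hypothesis mD : measurable D.
Hypothesis mw : measurable_fun D w.
Hypothesis w0 : forall x, D x -> 0 <= w x.

(** The radicand of [hellinger]: all estimates are made on squared distances, and roots are taken
    only at the end. *)
Definition hellinger_sqr (g h : T -> R) : \bar R :=
  (\int[mu]_(x in D)
    ((Num.sqrt (g x) - Num.sqrt (h x)) ^+ 2 * w x)%:E)%E.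

Lemma measurable_hellinger_integrand {g h : T -> R} :
  measurable_fun D g -> measurable_fun D h ->
  measurable_fun D
    (fun x => (Num.sqrt (g x) - Num.sqrt (h x)) ^+ 2 * w x).
Proof.
have msqrt : measurable_fun setT (@Num.sqrt R).
  by apply: continuous_measurable_fun; exact: sqrt_continuous.
move=> mg mh; apply: measurable_funM => //.
by apply: measurable_funX; apply: measurable_funB; exact: measurableT_comp.
Qed.

Lemma weighted_sqr_ge0 {r : R} {x : T} : D x -> 0 <= r ^+ 2 * w x.
Proof. by move=> Dx; rewrite mulr_ge0 ?sqr_ge0// w0. Qed.

Lemma hellinger_sqr_ge0 (g h : T -> R) : (0 <= hellinger_sqr g h)%E.
Proof.
by apply: integral_ge0 => x Dx; rewrite lee_fin weighted_sqr_ge0.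
Qed.

Lemma hellinger_sqr_le2 {g h : T -> R} :
  measurable_fun D g -> measurable_fun D h ->
  {ae mu, forall x, D x -> 0 <= g x} ->
  {ae mu, forall x, D x -> 0 <= h x} ->
  (\int[mu]_(x in D) (g x * w x)%:E = 1)%E ->
  (\int[mu]_(x in D) (h x * w x)%:E = 1)%E ->
  (hellinger_sqr g h <= 2%:E)%E.
Proof.
move=> mg mh g0 h0 g1 h1.
(* The densities are nonnegative only almost everywhere. Passing to absolute values makes the
   integrands nonnegative on all of [D], so that integrals add without an integrability argument. *)
have mabs (f : T -> R) : measurable_fun D f ->
    measurable_fun D (fun x => (`|f x| * w x)%:E).
  move=> mf; apply/measurable_EFinP; apply: measurable_funM => //.
  exact: measurableT_comp.
have int_abs (f : T -> R) : measurable_fun D f ->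
    {ae mu, forall x, D x -> 0 <= f x} ->
    (\int[mu]_(x in D) (`|f x| * w x)%:E =
     \int[mu]_(x in D) (f x * w x)%:E)%E.
  move=> mf f0; apply: ae_eq_integral => //; first exact: mabs.
    by apply/measurable_EFinP; exact: measurable_funM.
  by apply: filterS f0 => x f0 Dx; rewrite ger0_norm// f0.
have abs0 (f : T -> R) x : D x -> (0 <= (`|f x| * w x)%:E)%E.
  by move=> Dx; rewrite lee_fin mulr_ge0// w0.
apply: (@le_trans _ _
  (\int[mu]_(x in D) ((`|g x| * w x)%:E + (`|h x| * w x)%:E))%E).
  apply: ae_ge0_le_integral => //.
  - by move=> x Dx; rewrite lee_fin weighted_sqr_ge0.
  - by apply/measurable_EFinP; exact: measurable_hellinger_integrand.
  - by move=> x Dx; rewrite adde_ge0// abs0.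
  - by apply: emeasurable_funD; exact: mabs.
  - apply: filterS2 g0 h0 => x g0 h0 Dx.
    rewrite -EFinD lee_fin -mulrDl ler_wpM2r ?w0//.
    by rewrite !ger0_norm ?g0 ?h0// sqr_sqrtrB_le ?g0 ?h0.
rewrite ge0_integralD//; [|exact: abs0|exact: mabs|exact: abs0|exact: mabs].
by rewrite !int_abs// g1 h1 -EFinD lee_fin.
Qed.

(** This is [sqr_sqrtrB_le_shift] integrated against [w], whose total mass is [m]. Keeping the error
    term on the right avoids subtracting integrals that may be infinite. *)
Lemma hellinger_sqr_le_affine {a b m : R} {g h : T -> R} :
  0 <= a -> 0 <= b ->
  measurable_fun D g -> measurable_fun D h ->
  {ae mu, forall x, D x -> 0 <= g x} ->
  {ae mu, forall x, D x -> 0 <= h x} ->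
  (\int[mu]_(x in D) (w x)%:E = m%:E)%E ->
  (b%:E * hellinger_sqr g h <=
   2%:E * hellinger_sqr (fun x => a + g x * b)%R (fun x => a + h x * b)%R +
   (2 * (a * m))%:E)%E.
Proof.
move=> a0 b0 mg mh g0 h0 wE.
have mshift (f : T -> R) : measurable_fun D f ->
    measurable_fun D (fun x => a + f x * b).
  by move=> mf; apply: measurable_funD => //; exact: measurable_funM.
have mH (f k : T -> R) : measurable_fun D f -> measurable_fun D k ->
    measurable_fun D
      (fun x => ((Num.sqrt (f x) - Num.sqrt (k x)) ^+ 2 * w x)%:E).
  move=> mf mk; apply/measurable_EFinP.
  exact: measurable_hellinger_integrand.
have H0 (f k : T -> R) x : D x ->
    (0 <= ((Num.sqrt (f x) - Num.sqrt (k x)) ^+ 2 * w x)%:E)%E.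
  by move=> Dx; rewrite lee_fin weighted_sqr_ge0.
have mwE : measurable_fun D (fun x => (w x)%:E).
  exact/measurable_EFinP.
have w0E x : D x -> (0 <= (w x)%:E)%E by move=> Dx; rewrite lee_fin w0.
have a20 : 0 <= 2 * a by rewrite mulr_ge0.
(* The constant [2 a m] becomes the integral of [2 a w], so both sides merge into single integrals
   to be compared pointwise. *)
rewrite mulrA EFinM -wE /hellinger_sqr.
rewrite -!ge0_integralZl_EFin//; [|exact: H0|exact/mH/mshift/mh/mshift
  |exact: H0|exact: mH].
rewrite -ge0_integralD//.
- apply: ae_ge0_le_integral => //.
  + by move=> x Dx; rewrite mule_ge0 ?lee_fin ?weighted_sqr_ge0.
  + by apply: emeasurable_funM => //; exact: mH.
  + move=> x Dx; apply: adde_ge0; apply: mule_ge0; rewrite ?lee_fin ?w0//.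
    exact: weighted_sqr_ge0.
  + apply: emeasurable_funD; apply: emeasurable_funM => //.
    exact/mH/mshift/mh/mshift.
  + apply: filterS2 g0 h0 => x g0 h0 Dx.
    rewrite -!EFinM -EFinD lee_fin mulrA [X in _ <= X + _]mulrA -mulrDl.
    rewrite ler_wpM2r ?w0// [leLHS]mulrC.
    exact: sqr_sqrtrB_le_shift a0 b0 (g0 Dx) (h0 Dx).
- by move=> x Dx; rewrite mule_ge0 ?lee_fin ?weighted_sqr_ge0.
- by apply: emeasurable_funM => //; exact/mH/mshift/mh/mshift.
- by move=> x Dx; rewrite mule_ge0 ?lee_fin ?w0.
- by apply: emeasurable_funM.
Qed.

End HellingerSquare.

(** Here [d] stands for [K * eps n], [c] for [a n * gamma 0], and [J], [Jn] for the squared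
    distances before and after the shift. *)
Lemma shift_absorption {R : realFieldType} {d c J Jn : R} :
  0 < d -> 0 <= c -> c * (16 + d ^+ 4) <= d ^+ 4 -> d ^+ 2 < J -> J <= 2 ->
  (1 - c) * J <= 2 * Jn + 2 * c -> J <= 4 * Jn.
Proof.
move=> d0 c0 cd dJ J2 H.
have d20 : 0 < d ^+ 2 by rewrite exprn_gt0.
have dE : d ^+ 4 = d ^+ 2 * d ^+ 2 by rewrite -exprD.
(* One factor [d ^+ 2] is bounded by [J], the other by 2. Hence also [d ^+ 4 <= 4], and
   [c <= 4 / 20]. *)
have d4 : d ^+ 4 <= 2 * J by nra.
have c5 : c <= 1 / 5 by nra.
have : 16 * c <= 2 * J * (1 - c) by nra.
(* Absorbing [2 c <= (1 - c) J / 4] leaves [3/4 (1 - c) J <= 2 Jn]; as [1 - c >= 4/5], this gives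
   [J <= 10/3 Jn]. *)
nra.
Qed.

Theorem lemma3p2 (R : realType) (I : interval R) (w : R -> R)
    (q : nat -> {poly R}) (gamma : nat -> R)
    (hw : weight_with_ops I w q gamma)
    (p : nat) (hp : (1 <= p)%N)
    (g0 : R -> R) (hg0 : sobolev_density p I w g0)
    (eps a : nat -> R) (heps : forall n, 0 < eps n) :
  exists K0 : R, 0 < K0 /\
    forall K : R, K0 <= K ->
      (forall n, 0 < a n <=
         K ^+ 4 * eps n ^+ 4 / ((16 + K ^+ 4 * eps n ^+ 4) * gamma 0%N)) ->
      exists C : R, 0 < C /\ exists N : nat, forall n, (N <= n)%N ->
        forall g : R -> R, sobolev_density p I w g ->
          ((K * eps n)%:E < hellinger I w g g0)%E ->
          (hellinger I w g g0 <=
             C%:E * hellinger I w (shifted (gamma 0%N) (a n) g)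
                                  (shifted (gamma 0%N) (a n) g0))%E.
Proof.
(* [K] enters only through [0 < K * eps n], so 1 serves as threshold; 2 is the root of the constant
   4 in [shift_absorption], and the bound holds from [n = 0] on. *)
exists 1; split=> // K K1 ha; exists 2; split=> //; exists 0%N => n _ g hg.
have mI : measurable [set` I] by exact: measurable_itv.
have mw := weight_measurable hw; have w0 := weight_ge0 hw.
have G0 := ops_norm_gt0 hw 0.
have wE : (\int[@lebesgue_measure R]_(x in [set` I]) (w x)%:E
    = (gamma 0%N)%:E)%E.
  have := ops_orthogonal hw 0 0; rewrite (ops_first hw) eqxx mul1r => <-.
  by apply: eq_integral => x _; rewrite hornerC !mul1r.
have mdens f : sobolev_density p I w f -> measurable_fun [set` I] f.
  by case=> -[D [D0 mD _ _]] _ _; rewrite -D0; exact: mD.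
have mg := mdens _ hg; have mg0 := mdens _ hg0.
case: hg => _ gpos g1; case: hg0 => _ g0pos g01.
have d0 : 0 < K * eps n by rewrite mulr_gt0// (lt_le_trans ltr01).
have /andP[a0 aD] := ha n.
have c0 : 0 <= a n * gamma 0%N by rewrite ltW// mulr_gt0.
have cD : a n * gamma 0%N * (16 + (K * eps n) ^+ 4) <= (K * eps n) ^+ 4.
  move: aD; rewrite -exprMn ler_pdivlMr; last first.
    by rewrite mulr_gt0// addr_gt0// exprn_gt0.
  by rewrite -mulrA [gamma _ * _]mulrC.
(* By [cD], [a n * gamma 0] is at most [t / (16 + t) < 1] with [t = (K * eps n) ^+ 4]. *)
have b0 : 0 <= 1 - a n * gamma 0%N.
  have := exprn_gt0 4 d0; nra.
pose H := hellinger_sqr (mu := lebesgue_measure) (D := [set` I]) (w := w).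
pose gn := shifted (gamma 0%N) (a n) g; pose g0n := shifted (gamma 0%N) (a n) g0.
have J0 : (0 <= H g g0)%E by exact: hellinger_sqr_ge0.
have Jn0 : (0 <= H gn g0n)%E by exact: hellinger_sqr_ge0.
have J2 : (H g g0 <= 2%:E)%E by exact: hellinger_sqr_le2.
have Jb : ((1 - a n * gamma 0%N)%:E * H g g0 <=
    2%:E * H gn g0n + (2 * (a n * gamma 0%N))%:E)%E.
  by apply: hellinger_sqr_le_affine => //; exact: ltW.
rewrite -[hellinger I w g g0]/(sqrte (H g g0)).
rewrite -[hellinger I w _ _]/(sqrte (H gn g0n)).
move: (H g g0) (H gn g0n) J0 Jn0 J2 Jb => J Jn J0 Jn0 J2 Jb dJ.
suff JJn : (J <= (2 ^+ 2)%:E * Jn)%E.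
  have -> : 2%:E = sqrte (2 ^+ 2)%:E :> \bar R.
    by rewrite /= sqrtr_sqr ger0_norm.
  by rewrite -sqrteM ?lee_fin// lee_sqrt// mule_ge0.
(* [J] is finite because it is at most 2; an infinite [Jn] makes the claim trivial, which leaves an
   inequality between reals. *)
case: J J0 J2 Jb dJ => [J| |]// J0 J2 + dJ.
case: Jn Jn0 => [Jn| |]// Jn0 Jb; last by rewrite gt0_muley ?lte_fin// leey.
rewrite -EFinM lee_fin -natrX; apply: (shift_absorption d0 c0 cD) => //.
have := dJ; rewrite /= lte_fin => dJ'.
rewrite -(@sqr_sqrtr _ J)// ltr_sqr// nnegrE ?sqrtr_ge0//; exact: ltW.
Qed.
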